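(* For any $n,\delta\in\mathbb{N}$, if $G$ is a simple graph on $n$ vertices with minimum degree $\delta(G)\geq\delta$, and if $n\geq\frac{(\delta+1)(\delta+2)}{3}$, then for all integers $t\geq 3$, \[ i_t(G)\leq i_t(K_{\delta,n-\delta}). \]
   Context: All graphs are finite and simple. For a graph $G$, $i_t(G)$ denotes the number of independent sets of $G$ of size exactly $t$. $K_{a,b}$ is the complete bipartite graph with parts of sizes $a$ and $b$. *)

(* Defs.v *)
From mathcomp Require Import all_boot all_order all_algebra.

Set Implicit Arguments.
Unset Strict Implicit.
Unset Printing Implicit Defensive.

Record sgraph := SGraph {
  vertex :> finType;
  adj : rel vertex;
  adj_sym : symmetric adj;
  adj_irrefl : irreflexive adj }.

Arguments adj {s} x y.

Definition degree (G : sgraph) (x : G) : nat := #|[set y : G | adj x y]|.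

(* Every degree is smaller than #|G|, so the default value #|G| is never
   attained when G has a vertex; the graph without vertices gets 0. *)
Definition min_degree (G : sgraph) : nat :=
  \big[minn/#|G|]_(x : G) degree x.

Definition independent (G : sgraph) (A : {set G}) : bool :=
  [forall x in A, forall y in A, ~~ adj x y].

Definition num_indep (t : nat) (G : sgraph) : nat :=
  #|[set A : {set G} | independent A && (#|A| == t)]|.

Section CompleteBipartite.
Variables a b : nat.

Definition bip_adj : rel ('I_a + 'I_b)%type := fun x y =>
  match x, y with
  | inl _, inr _ | inr _, inl _ => true
  | _, _ => false
  end.

Lemma bip_adj_sym : symmetric bip_adj.
Proof. by case=> x [] y. Qed.

Lemma bip_adj_irrefl : irreflexive bip_adj.
Proof. by case. Qed.

Definition complete_bipartite : sgraph := SGraph bip_adj_sym bip_adj_irrefl.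

End CompleteBipartite.

(* Main.v *)
Require Import Defs.
From mathcomp Require Import all_boot all_order all_algebra.
From mathcomp Require Import zify.

(** Independent [t]-sets of [G] are [t]-cliques of the complement of [G], a
    graph in which every closed neighbourhood has at most [m = n - delta]
    vertices. The claim is that such a graph on [n] vertices has at most
    ['C(m, t) + 'C(n - m, t)] cliques of size [t]
    ([card_cliques_le]); the [t]-sets inside one side of the bipartition already
    give that many independent sets in the complete bipartite graph.

    The clique bound follows Chase's argument for triangles, which extends to
    every [t >= 3]. Averaged over the vertices [v], the number of [t]-cliques
    meeting the closed neighbourhood of [v] is at most the number of all
    [t]-subsets of that closed neighbourhood ([sum_cliques_meeting_le]). Hence
    some [v] satisfies this inequality on its own. Deleting its closed
    neighbourhood, of size [a <= m], destroys at most ['C(a, t)] cliques, and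
    induction bounds the rest; convexity of [x |-> 'C(x, t)] ([bin_convex])
    shows that exchanging blocks of sizes [a] and [b] for blocks of sizes [m]
    and [a + b - m] only increases the total.

    The averaged inequality is local. A clique [K] containing [v] gives the
    [t.-1]-set [K :\ v] of neighbours of [v]. A clique [K] not containing [v],
    but with a neighbour of [v], is recorded by the [t.+1]-set [S = v |: K] and
    its vertex [v]; a [t]-set of neighbours of [w] is recorded by adding [w],
    which then dominates the resulting [t.+1]-set. So it is enough that in each
    [t.+1]-set there are at most as many vertices of the first kind as of the
    second ([card_clique_apexes_le]), and this is where [t >= 3] matters: a
    clique on [t.+1] vertices minus one edge has two vertices of the first kind
    and [t.-1] of the second. *)

Set Implicit Arguments.
Unset Strict Implicit.
Unset Printing Implicit Defensive.

(** * Binomial coefficients *)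

Lemma bin_convex (a b m r t : nat) :
  a <= m -> b <= m -> a + b = m + r ->
  'C(a, t) + 'C(b, t) <= 'C(m, t) + 'C(r, t).
Proof.
move=> le_am le_bm eq_ab.
have le_ra : r <= a by lia.
have -> : b = r + (m - a) by lia.
rewrite -{2}(subnKC le_am); elim: (m - a) => [|k IHk]; first by rewrite !addn0.
case: t IHk => [|t] IHk; first by rewrite !bin0.
(* Both sides grow by Pascal's rule, the right one faster as [r <= a]. *)
have grow : 'C(r + k, t) <= 'C(a + k, t) by rewrite leq_bin2l ?leq_add2r.
by have := IHk; rewrite !addnS !binS; lia.
Qed.

(** * Counting cliques *)

Section Cliques.

Variables (T : finType) (e : rel T).
Hypothesis e_sym : symmetric e.
Hypothesis e_irr : irreflexive e.

Implicit Types (V K S : {set T}) (v w : T) (t : nat).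

Definition clique K : bool :=
  [forall x in K, forall y in K, (x != y) ==> e x y].

Definition cliques V t : {set {set T}} :=
  [set K : {set T} | [&& K \subset V, clique K & #|K| == t]].

Definition nbhd V v : {set T} := [set u in V | e v u].

Definition closed_nbhd V v : {set T} := v |: nbhd V v.

Definition cliques_meeting V t v : {set {set T}} :=
  [set K in cliques V t | ~~ [disjoint K & closed_nbhd V v]].

(** The pairs of a vertex [v] and a clique [K] in [cliques_meeting] with
    [v \notin K] are encoded as a set [S = v |: K] with a marked vertex [v];
    the apexes are the possible marks. *)
Definition clique_apexes S : {set T} :=
  [set v in S | clique (S :\ v) && [exists w in S, e v w]].

Definition dominating S : {set T} :=
  [set w in S | [forall x in S, (x != w) ==> e w x]].

Lemma cliqueP K :
  reflect {in K &, forall x y, x != y -> e x y} (clique K).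
Proof.
apply: (iffP forall_inP) => [eK x y xK yK xy | eK x xK].
  by have /forall_inP/(_ y yK)/implyP := eK x xK; apply.
by apply/forall_inP=> y yK; apply/implyP; apply: eK.
Qed.

Lemma notin_nbhd V v : v \notin nbhd V v.
Proof. by rewrite inE e_irr andbF. Qed.

Lemma card_closed_nbhd V v : #|closed_nbhd V v| = #|nbhd V v|.+1.
Proof. by rewrite cardsU1 notin_nbhd. Qed.

Lemma card_cliques_subset V t : #|cliques V t| <= 'C(#|V|, t).
Proof.
rewrite -cards_draws; apply/subset_leq_card/subsetP=> K.
by rewrite !inE => /and3P[-> _ ->].
Qed.

(** One apex has a neighbour in [S], which is dominating.
    Two apexes leave every other vertex of [S] dominating, since any pair of
    vertices of [S] other than the pair of apexes lies in one of the two
    cliques; a third apex makes all of [S] a clique. *)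
Lemma card_clique_apexes_le S :
  3 < #|S| -> #|clique_apexes S| <= #|dominating S|.
Proof.
move=> gt3S.
have dom v w : v \in clique_apexes S -> w \in S -> w != v -> e w v ->
  w \in dominating S.
  rewrite !inE => /and3P[vS /cliqueP cl_v _] wS wv ewv; rewrite wS /=.
  apply/forall_inP=> x xS; apply/implyP=> xw; have [->//|xv] := eqVneq x v.
  by apply: cl_v; rewrite ?inE ?wv ?xv // eq_sym.
have [->|[v vA]] := set_0Vmem (clique_apexes S); first by rewrite cards0.
have [/eqP|[v' /setD1P[v'v v'A]]] := set_0Vmem (clique_apexes S :\ v).
  rewrite setD_eq0 => /subset_leq_card; rewrite cards1 => /leq_trans-> //.
  have := vA; rewrite inE => /and3P[vS _ /exists_inP[w wS evw]].
  apply/card_gt0P; exists w; apply: (dom v) => //; last by rewrite e_sym.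
  by apply: contraTneq evw => ->; rewrite e_irr.
have vS : v \in S by case/setIdP: vA.
have v'S : v' \in S by case/setIdP: v'A.
have adj_other w : w \in S -> w != v -> w != v' -> e w v.
  move=> wS wv wv'; have:= v'A; rewrite inE => /and3P[_ /cliqueP cl _].
  by apply: cl => //; rewrite !inE ?wv' // eq_sym v'v.
have other w : w \in S -> w != v -> w != v' -> w \in dominating S.
  by move=> wS wv wv'; apply: (dom v) => //; apply: adj_other.
have [/eqP|[u /setD1P[uv' /setD1P[uv uA]]]] :=
  set_0Vmem (clique_apexes S :\ v :\ v').
  rewrite setDDl setD_eq0 => /subset_leq_card; rewrite cards2 eq_sym v'v.
  move=> /leq_trans-> //; apply: (@leq_trans #|S :\ v :\ v'|).
    have := cardsD1 v S; have := cardsD1 v' (S :\ v).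
    by rewrite vS !inE v'v v'S /=; lia.
  apply/subset_leq_card/subsetP=> w /setD1P[wv' /setD1P[wv wS]].
  exact: other.
have ev'v : e v' v.
  have:= uA; rewrite inE => /and3P[_ /cliqueP cl _].
  by apply: cl => //; rewrite !inE eq_sym ?uv' ?uv.
apply/subset_leq_card/subsetP=> w /setIdP[wS _].
have [->|wv] := eqVneq w v.
  by apply: (dom v'); rewrite 1?eq_sym // e_sym.
have [->|wv'] := eqVneq w v'; first exact: (dom v).
exact: other.
Qed.

(** The three lemmas below are the encodings that reduce the averaged
    inequality to one about single [t.+1]-sets; each of the maps [K :\ v],
    [v |: K] and [S :\ w] is injective because the added or removed vertex is
    fixed. *)
Lemma card_cliques_containing_le V t v :
  #|[set K in cliques_meeting V t.+1 v | v \in K]| <= 'C(#|nbhd V v|, t).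
Proof.
rewrite -cards_draws.
rewrite -[X in X <= _](@card_in_imset _ _ (fun K => K :\ v)); last first.
  move=> K K' /setIdP[_ vK] /setIdP[_ vK'] eqK.
  by rewrite -(setD1K vK) -(setD1K vK') eqK.
apply/subset_leq_card/subsetP=> _ /imsetP[K /setIdP[KM vK] ->].
move: KM; rewrite !inE => /andP[/and3P[KV /cliqueP cl_K /eqP cardK] _].
have := cardsD1 v K; rewrite vK cardK add1n => -[<-]; rewrite eqxx andbT.
apply/subsetP=> x /setD1P[xv xK]; rewrite inE (subsetP KV) //=.
by apply: cl_K; rewrite // eq_sym.
Qed.

Lemma card_cliques_avoiding_le V t v :
  v \in V ->
  #|[set K in cliques_meeting V t v | v \notin K]| <=
  #|[set S in [set S : {set T} | (S \subset V) && (#|S| == t.+1)]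
       | v \in clique_apexes S]|.
Proof.
move=> vV.
rewrite -[X in X <= _](@card_in_imset _ _ (fun K => v |: K)); last first.
  move=> K K' /setIdP[_ vK] /setIdP[_ vK'] eqK.
  by rewrite -(setU1K vK) -(setU1K vK') eqK.
apply/subset_leq_card/subsetP=> _ /imsetP[K /setIdP[KM vK] ->].
case/setIdP: KM; rewrite [K \in _]inE => /and3P[KV cl_K /eqP cardK].
rewrite -setI_eq0 => /set0Pn[w /setIP[wK /setU1P wN]].
have {wN} evw : e v w.
  case: wN => [wv|/setIdP[]//]; by rewrite -wv wK in vK.
rewrite !inE cardsU1 vK cardK add1n !eqxx subUset sub1set vV KV setU1K //.
rewrite cl_K /=.
by apply/exists_inP; exists w; rewrite // !inE wK orbT.
Qed.

Lemma card_dominated_le V t w :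
  #|[set S in [set S : {set T} | (S \subset V) && (#|S| == t.+1)]
       | w \in dominating S]| <= 'C(#|nbhd V w|, t).
Proof.
rewrite -cards_draws.
rewrite -[X in X <= _](@card_in_imset _ _ (fun S => S :\ w)); last first.
  move=> S S' /setIdP[_ /setIdP[wS _]] /setIdP[_ /setIdP[wS' _]] eqS.
  by rewrite -(setD1K wS) -(setD1K wS') eqS.
apply/subset_leq_card/subsetP=> _ /imsetP[S /setIdP[SV wS] ->].
move: SV wS; rewrite !inE => /andP[SV /eqP cardS] /andP[wS /forall_inP dom].
have := cardsD1 w S; rewrite wS cardS add1n => -[<-]; rewrite eqxx andbT.
apply/subsetP=> x /setD1P[xw xS]; rewrite inE (subsetP SV) //=.
exact: implyP (dom x xS) xw.
Qed.

Lemma sum_card_fibres (P : {set {set T}}) V (F : {set T} -> {set T}) :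
  (forall S, S \in P -> F S \subset V) ->
  \sum_(v in V) #|[set S in P | v \in F S]| = \sum_(S in P) #|F S|.
Proof.
move=> FV.
under eq_bigr => v _ do rewrite -sum1dep_card.
rewrite (exchange_big_dep (mem P)) /=; last by move=> v S _ /andP[].
apply: eq_bigr => S SP; rewrite -sum1_card; apply: eq_bigl => v.
rewrite SP /=; case: (boolP (v \in F S)) => [vF|]; last by rewrite andbF.
by rewrite (subsetP (FV S SP)).
Qed.

Lemma sum_cliques_meeting_le V t :
  2 < t ->
  \sum_(v in V) #|cliques_meeting V t v| <=
  \sum_(v in V) 'C(#|closed_nbhd V v|, t).
Proof.
case: t => // t gt2t.
pose P := [set S : {set T} | (S \subset V) && (#|S| == t.+2)].
have sub_P (F : {set T} -> {set T}) : (forall S, F S \subset S) ->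
  forall S, S \in P -> F S \subset V.
  by move=> FS S; rewrite inE => /andP[SV _]; exact: subset_trans (FS S) SV.
have apexes_sub S : clique_apexes S \subset S.
  by apply/subsetP=> x /setIdP[].
have dominating_sub S : dominating S \subset S.
  by apply/subsetP=> x /setIdP[].
pose avoiding v := #|[set S in P | v \in clique_apexes S]|.
apply: (@leq_trans (\sum_(v in V) ('C(#|nbhd V v|, t) + avoiding v))).
  apply: leq_sum => v vV.
  rewrite -(cardsID [set K : {set T} | v \in K] (cliques_meeting _ _ _)).
  rewrite leq_add //.
    by have := card_cliques_containing_le V t v; rewrite setIdE.
  apply: leq_trans (card_cliques_avoiding_le _ vV); rewrite subset_leq_card //.
  by apply/subsetP=> K; rewrite !inE andbC.
(* By Pascal's rule the right-hand side splits along the same two cases. *)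
under [X in _ <= X]eq_bigr => v _ do rewrite card_closed_nbhd binS addnC.
rewrite !big_split leq_add2l /= /avoiding (sum_card_fibres (sub_P _ _)) //.
apply: leq_trans (leq_sum _ (fun w _ => card_dominated_le V t.+1 w)).
rewrite (sum_card_fibres (sub_P _ _)) //; apply: leq_sum => S.
by rewrite inE => /andP[_ /eqP cardS]; rewrite card_clique_apexes_le ?cardS.
Qed.

Lemma exists_few_cliques_meeting V t :
  2 < t -> V != set0 ->
  exists2 v, v \in V & #|cliques_meeting V t v| <= 'C(#|closed_nbhd V v|, t).
Proof.
move=> gt2t /set0Pn[v0 v0V]; apply/exists_inP; apply: contraTT (leqnn 0).
rewrite negb_exists_in => /forall_inP many.
(* Were every term reversed, strictly at [v0], so would be the sums. *)
have := sum_cliques_meeting_le V gt2t; rewrite leqNgt => /negP[].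
rewrite (bigD1 v0) //= [X in _ < X](bigD1 v0) //= -addSn leq_add //.
  by rewrite ltnNge many.
by apply: leq_sum => v /andP[vV _]; rewrite ltnW // ltnNge many.
Qed.

(** When [#|V| <= m] the last term vanishes and all [t]-subsets are counted.
    Otherwise the closed neighbourhood [N] of a vertex meeting few cliques is
    deleted, and the degree condition is inherited by [V :\: N]. If that set
    has at most [m] vertices it is a second block to be balanced against [N];
    if not, the induction hypothesis already splits off a block of size [m]. *)
Theorem card_cliques_le V t m :
  2 < t -> {in V, forall v, #|closed_nbhd V v| <= m} ->
  #|cliques V t| <= 'C(m, t) + 'C(#|V| - m, t).
Proof.
move=> gt2t.
have [k] := ubnP #|V|; elim: k V => // k IHk V ltVk degV.
have [leVm|ltmV] := leqP #|V| m.
  apply: leq_trans (card_cliques_subset V t) _.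
  exact: leq_trans (leq_bin2l t leVm) (leq_addr _ _).
have V0 : V != set0 by rewrite -card_gt0; lia.
have [v vV few] := exists_few_cliques_meeting gt2t V0.
set a := #|closed_nbhd V v| in few; pose W := V :\: closed_nbhd V v.
have NV : closed_nbhd V v \subset V.
  by rewrite subUset sub1set vV; apply/subsetP=> x /setIdP[].
have cardW : #|W| = #|V| - a by rewrite cardsD (setIidPr NV).
have a_gt0 : 0 < a by rewrite /a card_closed_nbhd.
have le_am : a <= m by apply: degV.
have split_cliques : #|cliques V t| <= 'C(a, t) + #|cliques W t|.
  apply: leq_trans (leq_add few (leqnn _)).
  apply: leq_trans (leq_card_setU _ _); apply/subset_leq_card/subsetP=> K KV.
  rewrite !inE in KV *; have /and3P[sKV -> ->] := KV.
  by rewrite sKV /= andbT subsetD sKV /= orNb.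
apply: leq_trans split_cliques _.
have [leWm|ltmW] := leqP #|W| m.
  apply: leq_trans (leq_add (leqnn _) (card_cliques_subset W t)) _.
  by apply: bin_convex => //; lia.
have /IHk : #|W| < k by lia.
have degW : {in W, forall w, #|closed_nbhd W w| <= m}.
  move=> w /setDP[wV _]; apply: leq_trans (degV w wV).
  apply/subset_leq_card/setUS/subsetP=> x /setIdP[/setDP[xV _] ewx].
  by rewrite inE xV.
move=> /(_ degW) leW; apply: leq_trans (leq_add (leqnn _) leW) _.
rewrite addnCA leq_add2l.
(* Merging the blocks of sizes [a] and [#|W| - m] into one. *)
have bin_0t : 'C(0, t) = 0 by rewrite bin_small // (ltn_trans _ gt2t).
by rewrite -[X in _ <= X]addn0 -bin_0t; apply: bin_convex; lia.
Qed.

End Cliques.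

(** * Independent sets *)

Lemma min_degree_le (G : sgraph) (x : G) : min_degree G <= degree x.
Proof.
rewrite /min_degree; elim: (index_enum G) (mem_index_enum x) => // y s IHs.
rewrite inE big_cons geq_min => /predU1P[->|/IHs->]; first by rewrite leqnn.
by rewrite orbT.
Qed.

Lemma min_degree_le_order (G : sgraph) : min_degree G <= #|G|.
Proof.
rewrite /min_degree; elim: (index_enum G) => [|y s IHs].
  by rewrite big_nil.
by rewrite big_cons geq_min IHs orbT.
Qed.

Definition nonadj (G : sgraph) : rel G := fun x y => (x != y) && ~~ adj x y.

Lemma nonadj_sym (G : sgraph) : symmetric (@nonadj G).
Proof. by move=> x y; rewrite /nonadj eq_sym adj_sym. Qed.

Lemma nonadj_irr (G : sgraph) : irreflexive (@nonadj G).
Proof. by move=> x; rewrite /nonadj eqxx. Qed.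

Lemma independent_clique (G : sgraph) (A : {set G}) :
  independent A = clique (@nonadj G) A.
Proof.
apply: eq_forallb_in => x _; apply: eq_forallb_in => y _.
by rewrite /nonadj; case: eqVneq => [->|//]; rewrite adj_irrefl.
Qed.

Lemma num_indep_cliques (G : sgraph) (t : nat) :
  num_indep t G = #|cliques (@nonadj G) setT t|.
Proof.
by apply: eq_card => A; rewrite !inE subsetT independent_clique.
Qed.

Lemma card_closed_nbhd_nonadj (G : sgraph) (x : G) :
  #|closed_nbhd (@nonadj G) setT x| = #|G| - degree x.
Proof.
rewrite cardsCs /degree; congr (_ - #|pred_of_set _|); apply/setP=> y.
rewrite !inE /nonadj eq_sym; case: eqVneq => [->|_] /=.
  by rewrite adj_irrefl.
by rewrite negbK.
Qed.

Lemma num_indep_complete_bipartite_ge (a b t : nat) :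
  0 < t -> 'C(a, t) + 'C(b, t) <= num_indep t (complete_bipartite a b).
Proof.
move=> t_gt0; pose draws k := [set A : {set 'I_k} | #|A| == t].
pose L := [set inl @: A | A : {set 'I_a} in draws a] : {set {set 'I_a + 'I_b}}.
pose R := [set inr @: A | A : {set 'I_b} in draws b] : {set {set 'I_a + 'I_b}}.
have cardL : #|L| = 'C(a, t).
  by rewrite card_imset ?card_draws ?card_ord //; apply/imset_inj => x y [].
have cardR : #|R| = 'C(b, t).
  by rewrite card_imset ?card_draws ?card_ord //; apply/imset_inj => x y [].
have disjLR : L :&: R = set0.
  apply/setP=> B; rewrite inE in_set0; apply/negP => /andP[].
  case/imsetP=> A; rewrite inE => /eqP cardA -> /imsetP[A' _ eqA].
  have /card_gt0P[x xA] : 0 < #|A| by rewrite cardA.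
  by have := imset_f (inl : _ -> 'I_a + 'I_b)%type xA; rewrite eqA => /imsetP[].
rewrite -cardL -cardR -cardsUI disjLR cards0 addn0.
apply/subset_leq_card/subsetP=> B /setUP[] /imsetP[A].
  rewrite !inE => cardA ->.
  rewrite card_imset ?cardA ?andbT; last by move=> ? ? [].
  by apply/forall_inP=> _ /imsetP[x _ ->]; apply/forall_inP=> _ /imsetP[y _ ->].
rewrite !inE => cardA ->.
rewrite card_imset ?cardA ?andbT; last by move=> ? ? [].
by apply/forall_inP=> _ /imsetP[x _ ->]; apply/forall_inP=> _ /imsetP[y _ ->].
Qed.

Theorem theorem1p6 (n delta : nat) (G : sgraph) (t : nat) :
  #|G| = n ->
  delta <= min_degree G ->
  ((delta%:R + 1) * (delta%:R + 2) / 3 <= n%:R :> rat)%R ->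
  3 <= t ->
  num_indep t G <= num_indep t (complete_bipartite delta (n - delta)).
Proof.
move=> cardG le_delta _ ge3t.
apply: leq_trans (num_indep_complete_bipartite_ge _ _ (ltn_trans _ ge3t)) => //.
have degG (x : G) : x \in setT ->
  #|closed_nbhd (@nonadj G) setT x| <= n - delta.
  move=> _; rewrite card_closed_nbhd_nonadj cardG leq_sub2l //.
  exact: leq_trans le_delta (min_degree_le x).
rewrite num_indep_cliques addnC.
have := card_cliques_le (@nonadj_sym G) (@nonadj_irr G) ge3t degG.
rewrite cardsT cardG subKn //.
by rewrite -cardG (leq_trans le_delta) ?min_degree_le_order.
Qed.
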